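(* Let $w\in\mathbb{YF}_\infty^+$, $\beta\in(0,1)$ and $l\in\mathbb{N}_0$. Then 1) $\displaystyle\lim_{n\to\infty}\sum_{v\in\overline{Q}(w,n,l)}\mu_{w,\beta}(v)=0$; 2) $\displaystyle\lim_{n\to\infty}\sum_{v\in Q(w,n,l)}\mu_{w,\beta}(v)=1$.
   Context: Words. $\mathbb{YF}$ is the set of finite words over the alphabet $\{1,2\}$, including the empty word $\varepsilon$; $\mathbb{YF}_\infty$ is the set of left-infinite words $\ldots\alpha_2\alpha_1$ with $\alpha_i\in\{1,2\}$. For a word $x$, $|x|$ is the sum of its digits, $\#x$ its number of digits, $d(x)$ its number of digits $2$ (possibly $\infty$). $\mathbb{YF}_n=\{v\in\mathbb{YF}:|v|=n\}$. $xy$ denotes concatenation. $\mathbb{N}_0=\{0,1,2,\dots\}$. Graph. The Young–Fibonacci graph has vertex set $\mathbb{YF}$, graded by rank $|x|$. The edges going up from $x$ (to rank $|x|+1$) lead to the words obtained from $x$ by either replacing the leftmost digit $1$ by $2$ (if there is a $1$), or inserting a digit $1$ somewhere to the left of the leftmost $1$ (anywhere if $x$ contains no $1$). $d(x,y)$ is the number of paths from $y$ down to $x$ (rank decreasing by $1$ at each step). Function $g$. For a finite or infinite word $x$ and $1\le j\le d(x)$, $g(x,j)$ equals $1$ plus the sum of the digits standing to the right of the $j$-th digit $2$ of $x$ counted from the right. $\pi(w)=\prod_{i:\,g(w,i)>1}\frac{g(w,i)-1}{g(w,i)}$ (empty product is $1$), and $\mathbb{YF}_\infty^+=\{w\in\mathbb{YF}_\infty:\pi(w)>0\}$.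 $h(x,y)$ is the number of digits, and $h'(x,y)$ the sum of digits, of the longest common suffix of the words $x$ and $y$. Function $f$. $f(x,y,z)$ is defined for $x\in\mathbb{YF}$, $y\in\{0,\dots,|x|\}$, $z\in\{0,\dots,\#x\}$. For $z=0$: if $x=\alpha_1\cdots\alpha_n$ and there is $m\in\{0,\dots,n\}$ with $\alpha_{m+1}+\dots+\alpha_n=y$, then $$f(x,y,0)=(-1)^{n-m}\prod_{j=m+1}^{n}\frac1{\alpha_{m+1}+\dots+\alpha_j}\;\prod_{j=1}^{m}\frac{1}{\alpha_j+\dots+\alpha_m};$$ otherwise $f(x,y,0)=0$. For $z>0$, recursively: $f(x1,0,z)=f(x1,0,0)$; $f(x1,y,z)=f(x1,y,0)+f(x,y-1,z-1)$ if $y>0$; $f(x2,y,z)=\frac{f(x11,y,z+1)}{1-y}$ if $y\neq1$, and $f(x2,1,z)=0$. For $x,v\in\mathbb{YF}$, $w\in\mathbb{YF}_\infty$, $\beta\in(0,1]$, $$d'_\beta(x,w)=\sum_{i=0}^{|x|}\beta^i f(x,i,h(x,w))\prod_{j=1}^{d(w)}\frac{g(w,j)-i}{g(w,j)},\qquad \mu_{w,\beta}(v)=d(\varepsilon,v)\,d'_\beta(v,w)$$ (infinite products are limits of partial products). For $w\in\mathbb{YF}_\infty$, $n,l\in\mathbb{N}_0$: $Q(w,n,l)=\{v\in\mathbb{YF}_n: h'(v,w)\ge l\}$ and $\overline{Q}(w,n,l)=\{v\in\mathbb{YF}_n: h'(v,w)<l\}$. *)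

(* Defs.v *)
From HB Require Import structures.
From mathcomp Require Import all_boot all_order all_algebra finmap.
From mathcomp Require Import all_classical all_reals all_analysis.

Set Implicit Arguments.
Unset Strict Implicit.
Unset Printing Implicit Defensive.

Import Order.TTheory GRing.Theory Num.Theory.
Import numFieldNormedType.Exports.

Local Open Scope classical_set_scope.
Local Open Scope ring_scope.

Inductive digit := D1 | D2.

Definition is_D2 (a : digit) : bool := if a is D2 then true else false.
Definition digit_of_bool (b : bool) : digit := if b then D2 else D1.

Lemma is_D2K : cancel is_D2 digit_of_bool.
Proof. by case. Qed.

HB.instance Definition _ := Finite.copy digit (can_type is_D2K).

Definition digit_val (a : digit) : nat := if a is D2 then 2 else 1.

(* A finite word is listed from left to right; for an infinite word
   w = ... alpha_2 alpha_1, [w k] is alpha_(k+1). *)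
Notation word := (seq digit).
Notation iword := (nat -> digit).

Definition rank (x : word) : nat := (\sum_(a <- x) digit_val a)%N.

(* The word formed by the k rightmost digits of w. *)
Definition suffix (w : iword) (k : nat) : word := rev (mkseq w k).

(* An upward edge from x to y: u is the part (without 1s) of x to the left of
   the replaced, resp. inserted, digit. *)
Definition up_edge (x y : word) : Prop :=
  exists u v : word, all (pred1 D2) u /\
    (x = u ++ D1 :: v /\ y = u ++ D2 :: v \/ x = u ++ v /\ y = u ++ D1 :: v).

Definition up_paths (x y : word) : set (seq word) :=
  [set p | path (fun a b => `[< up_edge a b >]) x p /\ last x p = y].

(* The paper's d(x, y); [up_paths x y] is finite since each edge raises the
   rank by 1. *)
Definition num_paths (x y : word) : nat := #|` fset_set (up_paths x y)|%fset.

(* The digit [w k] is the j-th 2 of w, counted from the right from j = 1. *)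
Definition nth_two (w : iword) (j k : nat) : Prop :=
  w k = D2 /\ (count_mem D2 (suffix w k)).+1 = j.

(* 1 <= j <= d(w), where d(w) may be infinite. *)
Definition two_index (w : iword) (j : nat) : Prop := exists k, nth_two w j k.

(* Only meaningful when [two_index w j]. *)
Definition g (w : iword) (j : nat) : nat :=
  (1 + rank (suffix w (xget 0%N [set k | nth_two w j k])))%N.

Section RealValued.
Variable R : realType.

(* The product of F j over the j with 1 <= j <= d(w) and P j; the partial
   products are eventually constant when d(w) is finite. *)
Definition two_prod (w : iword) (P : pred nat) (F : nat -> R) : R :=
  limn (fun N : nat => \prod_(1 <= j < N.+1 | `[< two_index w j >] && P j) F j).

Definition piYF (w : iword) : R :=
  two_prod w (fun j => (1 < g w j)%N) (fun j => ((g w j)%:R - 1) / (g w j)%:R).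

(* Length and digit sum of the longest common suffix of a finite and an
   infinite word. *)
Definition h (x : word) (w : iword) : nat :=
  (\max_(k < (size x).+1 | drop (size x - k) x == suffix w k) k)%N.
Definition h' (x : word) (w : iword) : nat := rank (suffix w (h x w)).

(* f(x, y, 0); the digit alpha_j is the entry of index j - 1 of x. *)
Definition f0 (x : word) (y : nat) : R :=
  if [pick m : 'I_(size x).+1 | rank (drop m x) == y] is Some m then
    (-1) ^+ (size x - m)
    * (\prod_(m.+1 <= j < (size x).+1) (rank (drop m (take j x)))%:R^-1)
    * (\prod_(1 <= j < m.+1) (rank (drop j.-1 (take m x)))%:R^-1)
  else 0.

(* f(x1, y, z), given F = f(x, _, _). *)
Definition f_step1 (x : word) (F : nat -> nat -> R) (y z : nat) : R :=
  match z, y with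
  | 0%N, _ => f0 (rcons x D1) y
  | _.+1, 0%N => f0 (rcons x D1) 0
  | z'.+1, y'.+1 => f0 (rcons x D1) y + F y' z'
  end.

(* f(x2, y, z), given F = f(x, _, _). *)
Definition f_step2 (x : word) (F : nat -> nat -> R) (y z : nat) : R :=
  if z == 0%N then f0 (rcons x D2) y
  else if y == 1%N then 0
  else f_step1 (rcons x D1) (f_step1 x F) y z.+1 / (1 - y%:R).

(* The recursion consumes the word from the right, hence the reversal; the
   defining equations of f are the lemmas fz0 to f2_1 below. The value for
   x empty and z > 0 is outside the domain of f. *)
Fixpoint frev (r : word) : nat -> nat -> R :=
  match r with
  | [::] => fun y _ => f0 [::] y
  | D1 :: r' => f_step1 (rev r') (frev r')
  | D2 :: r' => f_step2 (rev r') (frev r')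
  end.

Definition f (x : word) (y z : nat) : R := frev (rev x) y z.

Lemma fz0 x y : f x y 0 = f0 x y.
Proof.
rewrite /f -[in RHS](revK x); case: (rev x) => [|[] r] //=;
by rewrite rev_cons.
Qed.

Lemma f1_0 x z : (0 < z)%N -> f (rcons x D1) 0 z = f (rcons x D1) 0 0.
Proof. by rewrite fz0 /f rev_rcons /= revK; case: z. Qed.

Lemma f1_pos x y z : (0 < y)%N -> (0 < z)%N ->
  f (rcons x D1) y z = f (rcons x D1) y 0 + f x y.-1 z.-1.
Proof. by rewrite fz0 /f rev_rcons /= revK; case: y z => [|y] [|z]. Qed.

Lemma f2_neq1 x y z : y != 1%N -> (0 < z)%N ->
  f (rcons x D2) y z = f (rcons (rcons x D1) D1) y z.+1 / (1 - y%:R).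
Proof.
rewrite /f !rev_rcons /= rev_cons revK /f_step2 => /negbTE -> z_gt0.
by rewrite gtn_eqF.
Qed.

Lemma f2_1 x z : (0 < z)%N -> f (rcons x D2) 1 z = 0.
Proof. by rewrite /f rev_rcons /= /f_step2; case: z. Qed.

Definition d'_ (beta : R) (x : word) (w : iword) : R :=
  \sum_(i < (rank x).+1)
    beta ^+ i * f x i (h x w)
    * two_prod w predT (fun j => ((g w j)%:R - i%:R) / (g w j)%:R).

Definition mu (w : iword) (beta : R) (v : word) : R :=
  (num_paths [::] v)%:R * d'_ beta v w.

End RealValued.

Definition YF (n : nat) : set word := [set v | rank v = n].

Definition Q (w : iword) (n l : nat) : set word :=
  [set v | YF n v /\ (l <= h' v w)%N].

Definition Qbar (w : iword) (n l : nat) : set word :=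
  [set v | YF n v /\ (h' v w < l)%N].

(* Main.v *)
Require Import Defs.
From mathcomp Require Import all_boot all_order all_algebra finmap.
From mathcomp Require Import all_classical all_reals all_analysis.
From mathcomp Require Import zify ring lra.
From mathcomp Require polyrcf.

Set Implicit Arguments.
Unset Strict Implicit.
Unset Printing Implicit Defensive.

Import Order.TTheory GRing.Theory Num.Theory.
Import numFieldNormedType.Exports.

Local Open Scope classical_set_scope.
Local Open Scope ring_scope.

(* Write e(v) = d(eps, v), h(v) = h(v, w) and P_i for the i-th infinite product,
   so that mu(v) = e(v) sum_i beta^i f(v, i, h(v)) P_i.  Adding a digit a on the
   left of v gives (|av| - i) f(av, i, h(av)) = f(v, i, h(v)), while e(1v) = e(v)
   and e(2v) = (|v| + 1) e(v).  Hence, for a property B of words that depends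
   only on the digits of a suffix of sum l, the sums a_(n,i) of e(v) f(v, i, h(v))
   over the words v of rank n with B satisfy
     (n - i) a_(n,i) = a_(n-1,i) + (n - 1) a_(n-2,i)   for n >= l + 2.
   Consider q_n = sum_i c_i a_(n,i).  Multiplying the weights c_i by 1 - i/g
   turns q_n into
     (1 - n/g) q_n + (1/g) q_(n-1) + ((n-1)/g) q_(n-2),
   a convex combination when n <= g.  Start from the weights of the finite suffix
   w_m of w of rank n: there q_n is 1 if w_m satisfies B and 0 otherwise, because
   sum_i f(v, i, h(v)) prod_j (g(w_m, j) - i) vanishes for v <> w_m of the same
   rank.  The digits 2 of w further to the left act by the above combinations with
   g = g(w, j); as 1/(n + 2) is multiplied by at most 1 + 2/g under such a
   combination, and prod_j (1 + 2/g(w, j)) converges since pi(w) > 0, the value of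
   q_n for beta = 1 differs from its starting value by O(1/n).  The weights beta^i
   are reached by the continuous analogue: with s = 1/beta, the polynomials
   p_n(s) = s^n q_n satisfy p_n' = p_(n-1) + (n - 1) s p_(n-2), which preserves
   the bound up to a factor s^2. *)

Local Notation suffix := Defs.suffix.

(** * Ranks and the function f(x, y, 0) *)

Lemma rank_nil : rank [::] = 0%N.
Proof. by rewrite /rank big_nil. Qed.

Lemma rank_cons a x : rank (a :: x) = (digit_val a + rank x)%N.
Proof. by rewrite /rank big_cons. Qed.

Lemma rank_cat x y : rank (x ++ y) = (rank x + rank y)%N.
Proof. by rewrite /rank big_cat. Qed.

Lemma rank_rcons x a : rank (rcons x a) = (rank x + digit_val a)%N.
Proof. by rewrite -cats1 rank_cat rank_cons rank_nil addn0. Qed.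

Lemma rankE x : rank x = (size x + count_mem D2 x)%N.
Proof. by elim: x => [|[] x IH]; rewrite ?rank_nil ?rank_cons ?IH //=; lia. Qed.

Lemma rank_eq0 x : (rank x == 0%N) = (x == [::]).
Proof. by case: x => [|[] x]; rewrite ?rank_nil ?rank_cons. Qed.

(** Digits are positive, so a word has at most one suffix of a given rank; hence the choice of [m]
    in [f0] is unambiguous. *)
Lemma rank_suffix_inj u v u' v' :
  u ++ v = u' ++ v' -> rank v = rank v' -> u = u' /\ v = v'.
Proof.
move=> E Ev; have Eu : rank u = rank u'.
  by have := congr1 rank E; rewrite !rank_cat Ev => /addIn.
elim: u u' E Eu => [|a u IH] [|b u'] //=.
- by rewrite rank_nil rank_cons; case: b.
- by rewrite rank_nil rank_cons; case: a.
- by case=> -> E; rewrite !rank_cons => /addnI /(IH _ E) [-> ->].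
Qed.

Section ZeroLevel.
Variable R : realType.
Implicit Types (x y u v : word) (i n : nat).

(** With [suffix_prod], the two products of [f0] at a split [u ++ v], separated because a digit
    added at one end affects only one of them. *)
Definition prefix_prod v : R :=
  \prod_(1 <= j < (size v).+1) (rank (take j v))%:R^-1.
Definition suffix_prod u : R :=
  \prod_(1 <= j < (size u).+1) (rank (drop j.-1 u))%:R^-1.

Lemma prefix_prod_rcons v b :
  prefix_prod (rcons v b) = prefix_prod v / (rank (rcons v b))%:R.
Proof.
rewrite /prefix_prod size_rcons big_nat_recr //= take_oversize ?size_rcons //.
congr (_ * _); apply: eq_big_nat => j /andP[_ jv].
by rewrite -cats1 takel_cat.
Qed.

Lemma suffix_prod_cons a u :
  suffix_prod (a :: u) = suffix_prod u / (rank (a :: u))%:R.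
Proof.
rewrite /suffix_prod /= big_nat_recl //= mulrC; congr (_ * _).
by rewrite !big_add1 /=; apply: eq_bigr => j _; case: j.
Qed.

Lemma f0_cat u v :
  f0 R (u ++ v) (rank v) = (-1) ^+ size v * prefix_prod v * suffix_prod u.
Proof.
rewrite /f0; case: pickP => [m /eqP|/(_ (inord (size u)))]; last first.
  by rewrite inordK ?drop_size_cat ?eqxx // size_cat ltnS leq_addr.
move: (nat_of_ord m) (ltn_ord m) => {}m mlt rm; have := cat_take_drop m (u ++ v).
move=> /rank_suffix_inj /(_ rm) [tm dm].
have sm : size u = m.
  by rewrite -tm size_takel.
rewrite tm.
rewrite size_cat -sm addKn; congr (_ * _ * _).
rewrite /prefix_prod -[X in \big[_/_]_(X <= _ < _) _ = _]add1n big_addn.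
rewrite -addnS addKn; apply: eq_big_nat => j jv.
have -> : take (j + size u) (u ++ v) = u ++ take j v.
  by rewrite take_cat; case: ltnP => //; [lia | rewrite addnK].
by rewrite drop_size_cat.
Qed.

Lemma f0_eq0 x i : (forall u v, x = u ++ v -> rank v <> i) -> f0 R x i = 0.
Proof.
move=> H; rewrite /f0; case: pickP => // m /eqP rm.
by case: (H (take m x) (drop m x)); rewrite ?cat_take_drop.
Qed.

Variant f0_spec x i : Prop :=
| F0split u v of x = u ++ v & rank v = i
| F0none of (forall u v, x = u ++ v -> rank v <> i) & f0 R x i = 0.

Lemma f0P x i : f0_spec x i.
Proof.
have [[u [v [xE vi]]]|H] := pselect (exists u v, x = u ++ v /\ rank v = i).
  exact: F0split xE vi.
have H' u v : x = u ++ v -> rank v <> i by move=> ? ?; apply: H; exists u, v.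
by apply: (F0none H'); apply: f0_eq0.
Qed.

Lemma f0_nil0 : f0 R [::] 0 = 1.
Proof.
have := f0_cat [::] [::]; rewrite /= rank_nil => ->.
by rewrite /prefix_prod /suffix_prod !big_geq // !mulr1.
Qed.

Lemma f0_gt x i : (rank x < i)%N -> f0 R x i = 0.
Proof.
by move=> lt; apply: f0_eq0 => u v E; move: lt; rewrite E rank_cat; lia.
Qed.

(** A digit added on the left divides [suffix_prod u] by the rank of [a :: u], which is |ax| - i
    when the right part has rank i. *)
Lemma f0_cons a x i : ((rank (a :: x))%:R - i%:R) * f0 R (a :: x) i = f0 R x i.
Proof.
have [u v -> <-|H ->] := f0P x i.
  rewrite f0_cat -cat_cons f0_cat suffix_prod_cons rank_cat natrD addrK.
  rewrite mulrC -!mulrA mulVf ?mulr1 // pnatr_eq0 rank_eq0 //.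
(* As [x] has no suffix of rank i, only the whole word [a :: x] can have that rank, and then the
   factor in front is zero. *)
have [[|b u] v E vi|H1 ->] := f0P (a :: x) i; last by rewrite mulr0.
  by rewrite E -vi subrr mul0r.
by case: E => _ E; case: (H _ _ E).
Qed.

Lemma f0_rcons x b i :
  (i + digit_val b)%:R * f0 R (rcons x b) (i + digit_val b) = - f0 R x i.
Proof.
have [u v -> <-|H ->] := f0P x i.
  rewrite rcons_cat -rank_rcons !f0_cat size_rcons prefix_prod_rcons exprS.
  rewrite !mulN1r !mulNr mulrN; congr (- _).
  rewrite [LHS]mulrC -!mulrA; congr (_ * (_ * _)).
  by rewrite mulrCA mulVf ?mulr1 // pnatr_eq0 rank_eq0 -size_eq0 size_rcons.
have [u v E vi|_ ->] := f0P (rcons x b) (i + digit_val b); last first.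
  by rewrite mulr0 oppr0.
case: (lastP v) E vi => [|v' c].
  by rewrite rank_nil; case: (b) => /=; lia.
rewrite -rcons_cat => /rcons_inj[xE ->]; rewrite rank_rcons => /addIn.
by move/(H _ _ xE).
Qed.

Lemma f0_rcons_lt x b i : (0 < i < digit_val b)%N -> f0 R (rcons x b) i = 0.
Proof.
move=> ib; apply: f0_eq0 => u v E; case: (lastP v) E => [|v' c].
  by rewrite rank_nil; lia.
rewrite -rcons_cat => /rcons_inj[_ <-]; rewrite rank_rcons; lia.
Qed.

(* Both recursions follow from [|x| = (|x| - i) + i]: the two factors shorten
   the word on the left and on the right. *)
Lemma sum_f0 x n : x != [::] -> (rank x < n)%N -> \sum_(i < n) f0 R x i = 0.
Proof.
have [k] := ubnP (size x); elim: k x n => // k IH x n.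
case: x => [//|a x]; rewrite ltnS => /= sx _ xn.
have xk : (rank (a :: x))%:R != 0 :> R by rewrite pnatr_eq0 rank_eq0.
apply/(mulfI xk); rewrite mulr0 mulr_sumr.
under eq_bigr => i _ do rewrite -[(rank _)%:R](subrK i%:R) mulrDl f0_cons.
rewrite big_split /=.
have E b y : (rank (rcons y b) < n)%N ->
  \sum_(i < n) i%:R * f0 R (rcons y b) i =
    - \sum_(i < n - digit_val b) f0 R y i.
  rewrite rank_rcons => bn; rewrite -sumrN.
  rewrite -(big_mkord xpredT (fun i => i%:R * f0 R (rcons y b) i)).
  rewrite (@big_cat_nat _ _ _ (digit_val b)) //=; last lia.
  rewrite big_nat big1 ?add0r; last first.
    move=> [_|i ib]; first by rewrite mul0r.
    by rewrite f0_rcons_lt ?mulr0 //; lia.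
  rewrite -{1}[digit_val b]add0n big_addn big_mkord.
  by apply: eq_bigr => i _; rewrite f0_rcons.
(* For a one-digit word both shortened sums belong to the empty word, equal 1 and cancel; otherwise
   both vanish by induction. *)
case: (eqVneq x [::]) => [x0|x0].
  move: xn; rewrite x0 -[[:: a]]/(rcons [::] a) => an.
  rewrite E //; move: an; rewrite rank_rcons rank_nil => an.
  have S m : (0 < m)%N -> \sum_(i < m) f0 R [::] i = 1.
    case: m => // m _; rewrite big_ord_recl f0_nil0 big1 ?addr0 // => i _.
    by rewrite f0_gt ?rank_nil.
  by rewrite !S ?subrr //; lia.
rewrite IH ?add0r //; last by move: xn; rewrite rank_cons; lia.
have [y [b xb]] : exists y b, a :: x = rcons y b.
  by exists (belast a x), (last a x); exact: lastI.
rewrite xb E; last by rewrite -xb.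
have := congr1 size xb; rewrite size_rcons /= => -[sy].
rewrite IH ?oppr0 //; first by rewrite -sy.
  by rewrite -size_eq0 -sy size_eq0.
by move: xn; rewrite xb rank_rcons; case: b {xb} => /=; lia.
Qed.

End ZeroLevel.

(** * Left recursion for f *)

Definition wtail (w : iword) : iword := fun k => w k.+1.

Lemma suffix0 w : suffix w 0%N = [::].
Proof. by []. Qed.

Lemma suffixS w m : suffix w m.+1 = w m :: suffix w m.
Proof. by rewrite /suffix mkseqS rev_rcons. Qed.

Lemma suffixSr w m : suffix w m.+1 = rcons (suffix (wtail w) m) (w 0%N).
Proof. by elim: m => [|m IH] //; rewrite suffixS IH suffixS. Qed.

Lemma size_word_suffix w m : size (suffix w m) = m.
Proof. by rewrite size_rev size_mkseq. Qed.

Lemma h_nil w : h [::] w = 0%N.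
Proof. by rewrite /h big_mkcond big_ord_recl big_ord0 //=. Qed.

Lemma h_rcons v a w :
  h (rcons v a) w = if a == w 0%N then (h v (wtail w)).+1 else 0%N.
Proof.
rewrite /h size_rcons [LHS]big_mkcond (big_ord_recl (size v).+1) /=.
rewrite (_ : (if _ then _ else _) = 0%N) ?max0n -?big_mkcond; last by case: ifP.
have E (k : nat) : (k < (size v).+1)%N ->
    (drop ((size v).+1 - k.+1) (rcons v a) == suffix w k.+1) =
    (a == w 0%N) && (drop (size v - k) v == suffix (wtail w) k).
  move=> kv; rewrite suffixSr subSS -cats1 drop_cat; case: ltnP => lt.
    by rewrite cats1 eqseq_rcons andbC.
  have k0 : k = 0%N by lia.
  by rewrite k0 subn0 subnn drop0 drop_size suffix0 /= eqseq_cons.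
case: eqP => [aw|aw]; last first.
  by rewrite big1 // => k; rewrite E //; case: eqP aw.
rewrite (eq_bigl (fun k : 'I_(size v).+1 =>
  drop (size v - k) v == suffix (wtail w) k)); last first.
  by move=> k; rewrite E // aw eqxx.
rewrite -(big_mkord (fun k => drop (size v - k) v == suffix (wtail w) k)
  (fun k => k.+1)) -(big_mkord (fun k => drop (size v - k) v == suffix _ k) id).
(* Replacing k by k + 1 raises a maximum by one only over a nonempty range; here k = 0 always
   matches. *)
rewrite -[LHS]big_filter -[in RHS]big_filter; set s := seq.filter _ _.
have : s != [::].
  rewrite -has_filter; apply/hasP; exists 0%N; first by rewrite mem_index_iota.
  by rewrite subn0 drop_size suffix0.
elim: s => // k [|j s] IH _; first by rewrite !big_cons !big_nil !maxn0.
by rewrite big_cons IH // [in RHS]big_cons /= maxnSS.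
Qed.

Lemma h_full v w : h v w = size v -> v = suffix w (size v).
Proof.
elim/last_ind: v w => [|v a IH] w //; rewrite h_rcons size_rcons.
by case: eqP => // -> [/IH {1}->]; rewrite -suffixSr.
Qed.

Lemma h_suffix w m : h (suffix w m) w = m.
Proof.
by elim: m w => [|m IH] w; rewrite ?suffix0 ?h_nil // suffixSr h_rcons eqxx IH.
Qed.

(* The possible pairs [z = h(av, w)], [z' = h(v, w)]: they can differ only when v
   itself is a suffix of w. *)
Definition prolongs (v : word) (z z' : nat) : Prop :=
  z = z' /\ (z' <= size v)%N \/ z = z'.+1 /\ z' = size v.

Lemma h_prolongs a v w : prolongs v (h (a :: v) w) (h v w).
Proof.
elim/last_ind: v w => [|v b IH] w.
  rewrite -[[:: a]]/(rcons [::] a) h_rcons !h_nil; case: eqP => _; [right|left]; done.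
rewrite -rcons_cons !h_rcons; case: eqP => _; last by left.
by case: (IH (wtail w)) => -[-> H]; [left|right]; rewrite size_rcons ?H.
Qed.

Section Recursions.
Variable R : realType.
Implicit Types (x y u v : word) (i n : nat) (F : nat -> R).

(** Multiplication by the variable, if a sequence in y is read as a generating series; it encodes
    the term f(x, y - 1, z - 1). *)
Definition ishift F i : R := if i is j.+1 then F j else 0.

Lemma f_rcons1 x i z :
  f R (rcons x D1) i z.+1 = f0 R (rcons x D1) i + ishift (fun j => f R x j z) i.
Proof. by case: i => [|i]; [rewrite f1_0 // fz0 addr0 | rewrite f1_pos // fz0]. Qed.

Lemma f_rcons2 x i z :
  f R (rcons x D2) i z.+1 = if i == 1%N then 0 else
   (f0 R (rcons (rcons x D1) D1) i + ishift (f0 R (rcons x D1)) i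
     + ishift (ishift (fun j => f R x j z)) i) / (1 - i%:R).
Proof.
case: eqP => [->|/eqP i1]; first by rewrite f2_1.
rewrite f2_neq1 // f_rcons1; case: i i1 => [|[|i]] //= _; rewrite ?addr0 //.
by rewrite f_rcons1 addrA.
Qed.

Lemma f_gt x i z : (rank x < i)%N -> f R x i z = 0.
Proof.
elim/last_ind: x i z => [|x a IH] i z.
  by rewrite /f /=; exact: f0_gt.
rewrite rank_rcons => lt; have lt1 : (rank x < i.-1)%N by case: a lt => /=; lia.
case: z => [|z]; first by rewrite fz0 f0_gt ?rank_rcons.
case: a lt => /= lt; last first.
  rewrite f_rcons2; case: i lt lt1 => [|[|i]] //= lt lt1.
  rewrite !f0_gt ?rank_rcons ?IH //=; try lia.
  by rewrite !addr0 mul0r.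
case: i lt lt1 => // i lt lt1.
by rewrite f_rcons1 f0_gt ?rank_rcons //= IH ?addr0 //; lia.
Qed.

(** The shape of [f0_cons], with r the rank of the longer word. It is stable under sums and, with r
    raised by one, under shifts. *)
Definition left_rel r F F' := forall i, (r%:R - i%:R) * F i = F' i.

Lemma left_rel_f0 a x : left_rel (rank (a :: x)) (f0 R (a :: x)) (f0 R x).
Proof. exact: f0_cons. Qed.

Lemma left_rel_shift r F F' : left_rel r F F' -> left_rel r.+1 (ishift F) (ishift F').
Proof.
move=> H [|i] /=; first by rewrite mulr0.
by rewrite -H -!natr1; congr (_ * _); ring.
Qed.

Lemma left_relD r F F' G G' : left_rel r F F' -> left_rel r G G' ->
  left_rel r (fun i => F i + G i) (fun i => F' i + G' i).
Proof. by move=> HF HG i; rewrite mulrDr HF HG. Qed.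

(** Induction from the right: both words end in the same digit, so the right recursion expands both
    sides into [f0] terms and shifts, each of which satisfies the relation. *)
Lemma f_left_rel a v z z' : prolongs v z z' ->
  left_rel (rank (a :: v)) (fun i => f R (a :: v) i z) (fun i => f R v i z').
Proof.
elim/last_ind: v z z' => [|v b IH] z z' zz'; last first.
  case: z' z zz' => [|z'] [|z] zz'; try by case: zz'; rewrite size_rcons; lia.
    by move=> i; rewrite !fz0 f0_cons.
  have {}zz' : prolongs v z z'.
    by case: zz' => -[[E1] E2]; [left|right]; move: E2; rewrite size_rcons => E2;
      split => //; lia.
  rewrite -rcons_cons; case: b => i.
    rewrite !f_rcons1; move: i; apply: left_relD; first exact: left_rel_f0.
    by rewrite rank_rcons addn1; apply/left_rel_shift/IH.
  rewrite !f_rcons2; case: eqP => _; first by rewrite mulr0.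
  rewrite mulrA; congr (_ / _); move: i.
  have -> : rank (rcons (a :: v) D2) = rank (rcons (rcons (a :: v) D1) D1).
    by rewrite !rank_rcons /=; lia.
  apply: left_relD; [apply: left_relD|].
  - exact: left_rel_f0.
  - by rewrite rank_rcons addn1; apply: left_rel_shift; exact: left_rel_f0.
  - by rewrite !rank_rcons !addn1; do 2!apply: left_rel_shift; exact: IH.
have -> : z' = 0%N by case: zz' => /= -[]; lia.
have [->|->] : z = 0%N \/ z = 1%N by case: zz' => /= -[]; lia.
  by move=> i; rewrite !fz0 f0_cons.
(* Here z = 1. For a single digit 2, the value 0 prescribed at i = 1 agrees with f(eps, 1, 0) =
   0. *)
move=> i; rewrite fz0 -[[:: a]]/(rcons [::] a).
have E j : f R [::] j 0 = f0 R [::] j by rewrite fz0.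
case: a; rewrite rank_rcons rank_nil.
  rewrite f_rcons1 mulrDr -(f0_cons R D1 [::] i) -[RHS]addr0.
  rewrite rank_cons rank_nil; congr (_ + _); case: i => [|[|i]]; rewrite /= ?mulr0 ?subrr ?mul0r //.
  by rewrite E f0_gt ?rank_nil // mulr0.
rewrite f_rcons2; case: i => [|[|[|i]]] /=.
- have H1 := f0_cons R D1 [::] 0; have H2 := f0_cons R D1 [:: D1] 0.
  move: H1 H2; rewrite !rank_cons !rank_nil /= subr0 mul1r => -> <-.
  by rewrite !addr0 !subr0 divr1.
- by rewrite mulr0 f0_gt ?rank_nil.
- by rewrite subrr mul0r f0_gt ?rank_nil.
- by rewrite E !f0_gt ?rank_cons ?rank_nil // !addr0 mul0r mulr0.
Qed.

End Recursions.

(** * Duality between f and the hook products *)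

(** Twice the number of 2s of a word is at most its rank, which is at most twice its length;
    equality throughout would force both words to consist of 2s only. *)
Lemma count_rcons_lt_size v y a b : (a, b) <> (D2, D2) ->
  rank (rcons v a) = rank (rcons y b) ->
  (count_mem D2 (rcons y b) < size (rcons v a))%N.
Proof.
have H x : (count_mem D2 x <= size x)%N := count_size _ _.
rewrite !rank_rcons !rankE size_rcons -cats1 count_cat.
move: (H v) (H y); move: (count_mem D2 v) (count_mem D2 y) (size v) (size y).
by case: a; case: b => //= *; lia.
Qed.

Section Triangularity.
Variable R : realType.
Implicit Types (x y u v : word) (i n : nat) (t : R).

(** The product of g - t over the digits 2 of y; at t = 0 it counts the paths from the empty word to
    y. *)
Fixpoint hook_prod y t : R :=
  if y is a :: y' then
    (if a is D2 then (rank y').+1%:R - t else 1) * hook_prod y' t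
  else 1.

Lemma hook_prod_rcons1 y t : hook_prod (rcons y D1) t = hook_prod y (t - 1).
Proof.
elim: y => [|a y IH] /=; first by rewrite mul1r.
rewrite IH; case: a => //; rewrite rank_rcons addn1 -natr1.
by congr (_ * _); ring.
Qed.

Lemma hook_prod_rcons2 y t :
  hook_prod (rcons y D2) t = (1 - t) * hook_prod y (t - 2).
Proof.
elim: y => [|a y IH] /=; first by rewrite rank_nil.
rewrite IH mulrCA; case: a => //; rewrite rank_rcons /= addn2 -2!natr1 -natr1.
by congr (_ * (_ * _)); ring.
Qed.

(** [hook_prod y] has degree d(y) in t, and [f0 x] annihilates polynomials of degree below #x: in a
    factor g - i = (g - |x|) + (|x| - i), the second summand removes the leftmost digit of x by
    [f0_cons]. *)
Lemma f0_hook_prod_orth x y n : (count_mem D2 y < size x)%N -> (rank x < n)%N ->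
  \sum_(i < n) f0 R x i * hook_prod y i%:R = 0.
Proof.
elim: y x => [|a y IH] x /= dx xn.
  under eq_bigr => i _ do rewrite mulr1.
  by apply: sum_f0 => //; case: x dx xn.
case: a dx => /= dx.
  by under eq_bigr => i _ do rewrite mul1r; apply: IH.
case: x dx xn => // b x; rewrite /= ltnS => dx xn.
transitivity (((rank y).+1%:R - (rank (b :: x))%:R) *
    (\sum_(i < n) f0 R (b :: x) i * hook_prod y i%:R) +
  \sum_(i < n) f0 R x i * hook_prod y i%:R).
  rewrite mulr_sumr -big_split.
  by apply: eq_bigr => i _ /=; rewrite -(f0_cons R b x); ring.
rewrite !IH ?mulr0 ?addr0 //=.
all: by move: xn dx; rewrite rank_cons; lia.
Qed.

Lemma sum_ishift (F G : nat -> R) n :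
  \sum_(i < n.+1) ishift F i * G i = \sum_(i < n) F i * G i.+1.
Proof. by rewrite big_ord_recl mul0r add0r. Qed.

(** If the last digits differ, f reduces to [f0] and orthogonality applies. If they agree, the [f0]
    terms drop out by orthogonality and the shifted term is the sum for the words without their last
    digit. *)
Lemma hook_prod_dual w m v n : rank v = rank (suffix w m) -> (rank v < n)%N ->
  \sum_(i < n) f R v i (h v w) * hook_prod (suffix w m) i%:R =
  (v == suffix w m)%:R.
Proof.
elim/last_ind: v w m n => [|v a IH] w m n.
  rewrite rank_nil => /esym/eqP; rewrite rank_eq0 => /eqP -> n0.
  rewrite eqxx h_nil; case: n n0 => // n _; rewrite big_ord_recl fz0 f0_nil0.
  by rewrite mulr1 big1 ?addr0 // => i _; rewrite f_gt ?mul0r ?rank_nil.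
case: m => [|m]; first by rewrite rank_nil rank_rcons; case: a => /=; lia.
set y := suffix w m.+1; have yE : y = rcons (suffix (wtail w) m) (w 0%N).
  exact: suffixSr.
rewrite h_rcons yE eqseq_rcons; move: (suffix (wtail w) m) {yE y} (IH (wtail w) m) => y {}IH.
rewrite !rank_rcons => rvy vn; case: eqP => [aw|aw]; last first.
  rewrite andbF.
  under eq_bigr => i _ do rewrite fz0.
  apply: f0_hook_prod_orth; last by rewrite rank_rcons.
  by apply: count_rcons_lt_size; [case=> aE bE; case: aw; rewrite aE | rewrite !rank_rcons].
rewrite -{}aw andbT in rvy *; have {}rvy : rank v = rank y by move: rvy; lia.
case: a vn => /= vn.
  under eq_bigr => i _ do rewrite f_rcons1 mulrDl.
  rewrite big_split /= f0_hook_prod_orth ?add0r; first last.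
  - by rewrite rank_rcons.
  - by apply: count_rcons_lt_size; rewrite // !rank_rcons rvy.
  case: n vn => [|n] vn; first lia.
  rewrite (sum_ishift _ (fun i => hook_prod (rcons y D1) i%:R)) -(IH n) //; last by move: vn; lia.
  by apply: eq_bigr => i _; rewrite hook_prod_rcons1 -natr1 addrK.
(* The factor 1 - i of [hook_prod_rcons2] cancels the denominator of [f_rcons2]. At i = 1, where f
   is 0 by definition, the bracket vanishes by [f0_rcons]. *)
transitivity (\sum_(i < n) (f0 R (rcons (rcons v D1) D1) i
    + ishift (f0 R (rcons v D1)) i
    + ishift (ishift (fun j => f R v j (h v (wtail w)))) i) * hook_prod y (i%:R - 2)).
  apply: eq_bigr => i _; rewrite f_rcons2 hook_prod_rcons2.
  case: eqP => [->|/eqP i1] /=.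
    have := f0_rcons R (rcons v D1) D1 0; rewrite /= add0n mul1r => ->.
    by rewrite addNr add0r !mul0r.
  by rewrite mulrA divfK // subr_eq0 eq_sym pnatr_eq1.
under eq_bigr => i _ do rewrite !mulrDl.
have hp1 i : hook_prod y (i.+1%:R - 2) = hook_prod (rcons y D1) i%:R.
  by rewrite hook_prod_rcons1 -natr1; congr hook_prod; ring.
case: n vn => [|[|n]] vn; try lia.
rewrite !big_split /= !(sum_ishift _ (fun i => hook_prod y (i%:R - 2))).
(* The value of [hook_prod y] at i - 2 is that of y11 at i, so orthogonality applies to v11 against
   y11. *)
rewrite -[X in X + _ + _](_ : \sum_(i < n.+2) f0 R (rcons (rcons v D1) D1) i *
  hook_prod (rcons (rcons y D1) D1) i%:R = _); last first.
  apply: eq_bigr => i _; rewrite !hook_prod_rcons1; congr (_ * hook_prod _ _); ring.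
rewrite f0_hook_prod_orth ?add0r; first last.
- by rewrite !rank_rcons /=; lia.
- by apply: count_rcons_lt_size; rewrite // !rank_rcons rvy.
under eq_bigr => i _ do rewrite hp1.
rewrite f0_hook_prod_orth ?add0r; first last.
- by rewrite !rank_rcons /=; lia.
- by apply: count_rcons_lt_size; rewrite // !rank_rcons rvy.
under eq_bigr => i _ do rewrite hp1.
rewrite (sum_ishift _ (fun i => hook_prod (rcons y D1) i%:R)) -(IH n) //; last by move: vn; lia.
by apply: eq_bigr => i _; rewrite hook_prod_rcons1 -natr1 addrK.
Qed.
End Triangularity.

(** * Paths from the empty word *)

(** A step down either turns into 1 a digit 2 with no 1 to its left, or deletes the leftmost 1. *)
Fixpoint downs (y : word) : seq word :=
  match y with
  | [::] => [::]
  | D1 :: v => [:: v]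
  | D2 :: v => (D1 :: v) :: map (cons D2) (downs v)
  end.

Lemma up_edge_downs x y : up_edge x y <-> x \in downs y.
Proof.
split=> [[u [v [u2 E]]]|].
  elim: u u2 x y E => [_|a u IH] /=.
    move=> x y [[-> ->]|[-> ->]] /=; first by rewrite inE eqxx.
    by rewrite inE.
  case/andP=> /eqP -> u2 x y; case=> -[-> ->] /=; rewrite inE /= mem_map;
    try by move=> ? ? [].
  - by rewrite (IH u2 (u ++ D1 :: v)) //; left.
  - by rewrite (IH u2 (u ++ v)) //; right.
elim: y x => [|[] v IH] x //=.
  by rewrite inE => /eqP ->; exists [::], v; split => //; right.
rewrite inE => /orP[/eqP ->|/mapP[x' /IH [u [t [u2 E]]] ->]].
  by exists [::], v; split => //; left.
exists (D2 :: u), t; split; first by rewrite /= u2.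
by case: E => -[-> ->]; [left|right].
Qed.

Lemma uniq_downs y : uniq (downs y).
Proof.
elim: y => [|[] v IH] //=; rewrite map_inj_uniq ?IH ?andbT; last by move=> ? ? [].
by apply/mapP => -[].
Qed.

Lemma rank_downs x y : x \in downs y -> rank y = (rank x).+1.
Proof.
elim: y x => [|[] v IH] x //=; rewrite inE; first by move=> /eqP ->; rewrite rank_cons.
case/orP => [/eqP ->|/mapP[x' /IH xv ->]]; rewrite !rank_cons ?xv //=; lia.
Qed.

Fixpoint path_list n (y : word) : seq (seq word) :=
  if n is n'.+1 then [seq rcons p y | u <- downs y, p <- path_list n' u]
  else [:: [::]].

Lemma mem_path_list n y p : rank y = n ->
  (p \in path_list n y) <-> up_paths [::] y p.
Proof.
elim: n y p => [|n IH] y p.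
  move/eqP; rewrite rank_eq0 => /eqP -> /=; rewrite inE.
  case/lastP: p => [|p z]; first by split.
  split; first by rewrite -size_eq0 size_rcons.
  rewrite /up_paths /= rcons_path last_rcons => -[/andP[_ /asboolP]] /[swap] ->.
  by move/up_edge_downs.
move=> ry; split => [/allpairsPdep[u [q [uy qu ->]]]|].
  have ru : rank u = n by have := rank_downs uy; rewrite ry => -[].
  case/(IH _ _ ru): qu => qp ql; rewrite /up_paths /= rcons_path last_rcons qp ql.
  by split => //; apply/asboolP/up_edge_downs.
case/lastP: p => [|q z].
  by case=> _ /= y0; move: ry; rewrite -y0 rank_nil.
rewrite /up_paths /= rcons_path last_rcons => -[/andP[qp /asboolP qz] zy].
move: qz; rewrite {z}zy => /up_edge_downs qy.
apply/allpairsPdep; exists (last [::] q), q; split => //.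
by apply/IH; [have := rank_downs qy; rewrite ry => -[] | split].
Qed.

Lemma uniq_path_list n y : rank y = n -> uniq (path_list n y).
Proof.
elim: n y => [|n IH] y ry //=.
have rn u : u \in downs y -> rank u = n by move=> /rank_downs; rewrite ry => -[].
apply: allpairs_uniq_dep; first exact: uniq_downs.
  by move=> u /rn; exact: IH.
move=> _ _ /allpairsPdep[u [p [uy pu ->]]] /allpairsPdep[v [q [vy qv ->]]] /=.
case/rcons_inj => pq; rewrite -{}pq in qv *.
case/(mem_path_list _ (rn u uy)): pu => _ <-.
by case/(mem_path_list _ (rn v vy)): qv => _ <-.
Qed.

Lemma num_pathsE y : num_paths [::] y = size (path_list (rank y) y).
Proof.
rewrite /num_paths (_ : up_paths [::] y = [set` [fset p in path_list (rank y) y]%fset]).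
  by rewrite set_fsetK card_fseq undup_id // uniq_path_list.
apply/seteqP; split => p /=; rewrite inE => H; exact/(mem_path_list _ (erefl _)).
Qed.

Section Dimension.
Variable R : realType.

(** Below 2v lie 1v, contributing the product of v once, and the words 2u with u below v,
    contributing it |v| times by induction; together this is the factor |v| + 1. *)
Lemma sum_downs y :
  \sum_(u <- downs y) hook_prod u (0 : R) = (y != [::])%:R * hook_prod y 0.
Proof.
elim: y => [|[] v IH] /=; first by rewrite big_nil mul0r.
  by rewrite big_seq1 !mul1r.
rewrite big_cons big_map /= !mul1r subr0 -natr1 mulrDl mul1r addrC; congr (_ + _).
rewrite big_seq; under eq_bigr => u uv do rewrite subr0 -(rank_downs uv).
rewrite -big_seq -mulr_sumr IH.
by case: v {IH} => [|a v]; rewrite ?rank_nil ?mul0r // mul1r.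
Qed.

Lemma num_paths_hook y : (num_paths [::] y)%:R = hook_prod y 0 :> R.
Proof.
rewrite num_pathsE; move En: (rank y) => n; elim: n y En => [|n IH] y ry.
  by move/eqP: ry; rewrite rank_eq0 => /eqP ->.
rewrite /= size_allpairs_dep sumnE big_map natr_sum.
have y0 : y != [::] by rewrite -rank_eq0 ry.
have := sum_downs y; rewrite y0 mul1r => <-.
rewrite big_seq [RHS]big_seq; apply: eq_bigr => u /rank_downs.
by rewrite ry => -[/esym /IH ->].
Qed.

Lemma hook_prod_gt0 y : 0 < hook_prod y (0 : R).
Proof.
by elim: y => [|[] y IH] //=; rewrite ?mul1r // subr0 mulr_gt0 ?ltr0n.
Qed.

End Dimension.

(** * Enumeration of the words of a given rank by their leftmost digit *)

Fixpoint words n : seq word :=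
  match n with
  | 0 => [:: [::]]
  | 1 => [:: [:: D1]]
  | (n''.+1 as n').+1 => map (cons D1) (words n') ++ map (cons D2) (words n'')
  end.

Lemma wordsSS n :
  words n.+2 = map (cons D1) (words n.+1) ++ map (cons D2) (words n).
Proof. by []. Qed.

Lemma mem_words n v : (v \in words n) = (rank v == n).
Proof.
elim/ltn_ind: n v => -[|[|n]] IH v.
- by rewrite inE rank_eq0.
- rewrite inE; case: v => [|[] v]; rewrite ?rank_nil ?rank_cons //.
  by rewrite add1n eqSS rank_eq0 eqseq_cons eqxx.
rewrite wordsSS mem_cat; case: v => [|a v].
  by rewrite rank_nil; apply/norP; split; apply/mapP => -[].
have inj b : injective (cons b : word -> word) by move=> ? ? [].
have out b c s : b != c -> ((b :: v) \in [seq c :: i | i <- s]) = false.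
  by move=> bc; apply/mapP => -[? _ [/eqP]]; rewrite (negbTE bc).
by case: a; [rewrite (out D1 D2) // orbF | rewrite (out D2 D1) //];
  rewrite (mem_map (@inj _)) IH // rank_cons.
Qed.

Lemma uniq_words n : uniq (words n).
Proof.
elim/ltn_ind: n => -[|[|n]] IH //.
have inj b : injective (cons b : word -> word) by move=> ? ? [].
rewrite wordsSS cat_uniq !map_inj_uniq ?IH //= andbT.
by apply/hasPn => _ /mapP[v _ ->]; apply/mapP => -[].
Qed.

(** * Sums over a level of the graph *)

Section LevelSums.
Variables (R : realType) (w : iword) (B : pred word) (l : nat).
Hypothesis B_cons : forall a v, (l <= rank v)%N -> B (a :: v) = B v.

Definition coef n i : R :=
  \sum_(v <- words n | B v) hook_prod v 0 * f R v i (h v w).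

Lemma coef_gt n i : (n < i)%N -> coef n i = 0.
Proof.
move=> ni; rewrite /coef big_seq_cond big1 // => v /andP[].
by rewrite mem_words => /eqP vn _; rewrite f_gt ?mulr0 ?vn.
Qed.

(** The sum is split by the leftmost digit, which [B] does not see since l <= n. *)
Lemma coef_rec n i : (l <= n)%N ->
  (n.+2%:R - i%:R) * coef n.+2 i = coef n.+1 i + n.+1%:R * coef n i.
Proof.
move=> ln; rewrite /coef wordsSS big_cat !big_map mulrDr !mulr_sumr.
congr (_ + _).
  rewrite big_seq_cond [RHS]big_seq_cond.
  apply: eq_big => [v|v /andP[]]; rewrite mem_words; case: eqP => //= vn.
    by rewrite B_cons // vn leqW.
  move=> _ _; rewrite -(f_left_rel R D1 (h_prolongs D1 v w) i) rank_cons vn /= add1n.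
  by rewrite mul1r mulrCA.
rewrite big_seq_cond [RHS]big_seq_cond.
apply: eq_big => [v|v /andP[]]; rewrite mem_words; case: eqP => //= vn.
  by rewrite B_cons // vn.
move=> _ _; rewrite -(f_left_rel R D2 (h_prolongs D2 v w) i) rank_cons vn /= add2n.
by rewrite subr0; ring.
Qed.

Definition level_sum (c : nat -> R) n : R := \sum_(i < n.+1) c i * coef n i.

Lemma level_sum_widen c n N : (n < N)%N ->
  level_sum c n = \sum_(i < N) c i * coef n i.
Proof.
move=> nN; rewrite /level_sum -!(big_mkord xpredT (fun i => c i * coef n i)).
rewrite [RHS](@big_cat_nat _ _ _ n.+1) //= [X in _ = _ + X]big_nat.
rewrite [X in _ = _ + X]big1 ?addr0 //.
by move=> i /andP[ni _]; rewrite coef_gt ?mulr0.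
Qed.

(** The i-th product restricted to the digits 2 among the m rightmost digits of w. *)
Definition weight m i : R :=
  hook_prod (suffix w m) i%:R / hook_prod (suffix w m) 0.

(** The value of g at the digit [w m] when it is a 2, indexed by position rather than by the number
    of the 2. *)
Definition gap m : R := (rank (suffix w m)).+1%:R.

Lemma weightS m i :
  weight m.+1 i = (if w m is D2 then 1 - i%:R / gap m else 1) * weight m i.
Proof.
rewrite /weight suffixS /=; case: (w m); first by rewrite !mul1r.
rewrite subr0 invfM mulrACA; congr (_ * _).
by rewrite mulrBl divff // pnatr_eq0.
Qed.

(** Write 1 - i/g as (1 - (n+2)/g) + (n+2-i)/g; by [coef_rec] the second part descends to levels n +
    1 and n. *)
Lemma level_sum_step n g (c c' : nat -> R) : (l <= n)%N -> g != 0 ->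
  (forall i, c' i = (1 - i%:R / g) * c i) ->
  level_sum c' n.+2 = (1 - n.+2%:R / g) * level_sum c n.+2 +
    g^-1 * level_sum c n.+1 + n.+1%:R / g * level_sum c n.
Proof.
move=> ln g0 cc'; rewrite /(level_sum c' n.+2).
rewrite (@level_sum_widen c n n.+3) 1?(@level_sum_widen c n.+1 n.+3) //; last lia.
rewrite !mulr_sumr -!big_split; apply: eq_bigr => i _ /=; rewrite cc'.
have -> : coef n.+1 i = (n.+2%:R - i%:R) * coef n.+2 i - n.+1%:R * coef n i.
  by rewrite coef_rec // addrK.
by field.
Qed.

(** Exchanging the sums leaves, for each v, the sum of [hook_prod_dual], which selects the single
    word [suffix w m]. *)
Lemma level_sum_top m : level_sum (weight m) (rank (suffix w m)) = (B (suffix w m))%:R.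
Proof.
rewrite /level_sum /coef; set y := suffix w m.
have y0 : hook_prod y 0 != 0 :> R by rewrite gt_eqF ?hook_prod_gt0.
transitivity (\sum_(v <- words (rank y) | B v) (v == y)%:R : R).
  under eq_bigr => i _ do rewrite mulr_sumr.
  rewrite exchange_big /= big_seq_cond [RHS]big_seq_cond; apply: eq_bigr => v.
  rewrite mem_words => /andP[/eqP vy _].
  transitivity (hook_prod v 0 / hook_prod y 0 * (v == y)%:R : R); last first.
    by case: eqP => [->|_]; rewrite ?mulr0 // mulr1 divff.
  rewrite -(@hook_prod_dual R w m v (rank y).+1) ?vy // mulr_sumr.
  by apply: eq_bigr => i _; rewrite /weight -/y; field.
have Hy : y \in words (rank y) by rewrite mem_words.
rewrite big_mkcond (bigD1_seq y) ?uniq_words //= eqxx big1 ?addr0.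
  by case: ifP.
by move=> v /negbTE ->; rewrite if_same.
Qed.
End LevelSums.

(** * The products over the digits 2 of w *)

Section TwoProducts.
Variables (R : realType) (w : iword).

(** Translates positions in w, which index [weight], into numbers of 2s, which index [two_prod]. *)
Definition twos m := count_mem D2 (suffix w m).

Lemma twosS m : twos m.+1 = ((w m == D2) + twos m)%N.
Proof. by rewrite /twos suffixS. Qed.

Lemma twos_homo : {homo twos : m n / (m <= n)%N}.
Proof.
by apply: homo_leq => [//|//|m]; [apply: leq_trans | rewrite twosS leq_addl].
Qed.

Lemma twos_lt m k : w m = D2 -> (m < k)%N -> (twos m < twos k)%N.
Proof. by move=> wm /twos_homo; rewrite twosS wm. Qed.

Lemma nth_two_inj j k k' : nth_two w j k -> nth_two w j k' -> k = k'.
Proof.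
rewrite /nth_two -!/(twos _) => -[wk <-] [wk' [E]].
by case: (ltngtP k k') => // /twos_lt; [move/(_ wk)|move/(_ wk')]; rewrite E ltnn.
Qed.

Lemma nth_twoS m : w m = D2 -> nth_two w (twos m).+1 m.
Proof. by []. Qed.

Lemma g_nth_two m : w m = D2 -> g w (twos m).+1 = (rank (suffix w m)).+1.
Proof.
move=> /nth_twoS mj; rewrite /g add1n; case: xgetP => [k _ kj|/(_ m)//].
by rewrite (nth_two_inj kj mj).
Qed.

Lemma gapE m : w m = D2 -> gap R w m = (g w (twos m).+1)%:R.
Proof. by move=> /g_nth_two ->. Qed.

Section Partial.
Variables (P : pred nat) (F : nat -> R).

Definition partial N := \prod_(1 <= j < N.+1 | `[< two_index w j >] && P j) F j.

Lemma partial0 : partial 0 = 1.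
Proof. by rewrite /partial big_geq. Qed.

Lemma partialS N : partial N.+1 =
  partial N * (if `[< two_index w N.+1 >] && P N.+1 then F N.+1 else 1).
Proof. by rewrite /partial big_mkcond big_nat_recr //= -big_mkcond. Qed.

Lemma partial_twosS m : partial (twos m.+1) =
  partial (twos m) *
  (if (w m == D2) && P (twos m).+1 then F (twos m).+1 else 1).
Proof.
rewrite twosS; case: eqP => [wm|_] /=; last by rewrite mulr1.
rewrite add1n partialS; have -> // : `[< two_index w (twos m).+1 >] = true.
by apply/asboolP; exists m; exact: nth_twoS.
Qed.

(** Numbers beyond d(w) contribute the factor 1, so every partial product occurs at some position m,
    even when w has finitely many 2s; m >= M lets limits along positions be transferred. *)
Lemma partial_twos M N : (twos M <= N)%N ->
  exists2 m, (M <= m)%N & partial N = partial (twos m).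
Proof.
elim: N => [|N IH]; first by rewrite leqn0 => /eqP E; exists M; rewrite ?E.
rewrite leq_eqVlt => /orP[/eqP <-|]; first by exists M.
rewrite ltnS => MN; have [m Mm E] := IH MN.
have [[k [wk [kN]]]|no] := pselect (two_index w N.+1); last first.
  by exists m => //; rewrite partialS asboolF // mulr1.
exists k.+1; last by rewrite twosS wk eqxx add1n /twos kN.
rewrite leqW // leqNgt; apply/negP => /(twos_lt wk).
by rewrite {1}/twos kN ltnNge MN.
Qed.

Lemma two_prodE (L : R) :
  (fun m => partial (twos m)) @ \oo --> L -> two_prod w P F = L.
Proof.
move=> cv; apply: cvg_lim => //; apply/cvgrPdist_lt => e e0.
have /cvgrPdist_lt/(_ e e0) [M _ HM] := cv.
exists (twos M) => // N /= /partial_twos[m Mm]; rewrite /partial => ->.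
exact: HM.
Qed.

End Partial.

Lemma rank_suffix_ge m : (m <= rank (suffix w m))%N.
Proof. by rewrite rankE size_word_suffix leq_addr. Qed.

Lemma weight_partial i m : weight R w m i =
  partial predT (fun j => ((g w j)%:R - i%:R) / (g w j)%:R) (twos m).
Proof.
elim: m => [|m IH]; first by rewrite partial0 /weight /= divr1.
rewrite weightS partial_twosS -IH mulrC andbT; congr (_ * _).
case: (w m) (@gapE m) => //= /(_ erefl) <-.
by rewrite mulrBl divff // pnatr_eq0.
Qed.

Definition limit_weight i : R :=
  two_prod w predT (fun j => ((g w j)%:R - i%:R) / (g w j)%:R).

(** From position i on, g exceeds i, so the factors lie in [0, 1] and their products decrease; the
    first i factors, which may be negative, are split off. *)
Lemma weight_is_cvg i : cvgn (weight R w ^~ i).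
Proof.
pose u m : R := \prod_(i <= k < i + m) (if w k is D2 then 1 - i%:R / gap R w k else 1).
have Hf k : (i <= k)%N -> 0 <= (if w k is D2 then 1 - i%:R / gap R w k else 1) <= 1.
  move=> ik; case: (w k); first by rewrite ler01 lexx.
  rewrite subr_ge0 gerBl ler_pdivrMr ?ltr0n // mul1r ler_nat divr_ge0 ?ler0n // andbT.
  exact: leq_trans ik (leqW (rank_suffix_ge k)).
have uS m : u m.+1 = u m * (if w (i + m)%N is D2 then 1 - i%:R / gap R w (i + m)%N else 1).
  by rewrite /u addnS big_nat_recr //= leq_addr.
have u0 m : 0 <= u m.
  by rewrite /u big_nat; apply: prodr_ge0 => k /andP[/Hf /andP[]].
have ucv : cvgn u.
  apply: nonincreasing_is_cvgn.
    apply/nonincreasing_seqP => m; rewrite uS ler_piMr //.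
    by case/andP: (Hf _ (leq_addr m i)).
  by exists 0 => _ [m _ <-].
apply/cvg_ex; exists (weight R w i i * limn u).
rewrite -(cvg_shiftn i).
have -> : [sequence weight R w (n + i)%N i]_n = (fun n => weight R w i i * u n).
  apply/funext => n; rewrite /= addnC; elim: n => [|n IH].
    by rewrite addn0 /u addn0 big_geq ?mulr1.
  by rewrite addnS weightS IH uS mulrC mulrA.
exact: cvgMl_tmp.
Qed.

Lemma weight_cvg i : weight R w ^~ i @ \oo --> limit_weight i.
Proof.
have cv := @weight_is_cvg i; have := cv; rewrite /limit_weight.
rewrite (@two_prodE _ _ (limn (weight R w ^~ i))) //.
by under eq_fun do rewrite -weight_partial.
Qed.

Definition growth m : R := \prod_(k < m) (if w k is D2 then 1 + 2 / gap R w k else 1).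

Lemma growthS m : growth m.+1 = growth m * (if w m is D2 then 1 + 2 / gap R w m else 1).
Proof. by rewrite /growth big_ord_recr. Qed.

Lemma growth_ge1 m : 1 <= growth m.
Proof.
elim: m => [|m IH]; first by rewrite /growth big_ord0.
rewrite growthS; apply: le_trans IH _; rewrite ler_peMr //.
  by rewrite /growth; apply: prodr_ge0 => k _; case: (w k) => //;
    rewrite addr_ge0 ?divr_ge0.
by case: (w m) => //; rewrite lerDl divr_ge0.
Qed.

(* [(1 + 2/g)(1 - 1/g)^2 <= 1], so the growth factor is controlled by [pi(w)];
   the constant accounts for a rightmost digit 2, whose [g] is 1. *)
Lemma growth_bound m : 0 < piYF R w -> growth m <= 3 / piYF R w ^+ 2.
Proof.
move=> pi0; pose pp := partial (fun j => (1 < g w j)%N)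
  (fun j => ((g w j)%:R - 1) / (g w j)%:R).
have ppS N : exists2 c, 0 <= c <= 1 & pp N.+1 = pp N * c.
  rewrite /pp partialS; set c := (if _ then _ else _); exists c => //; rewrite {}/c.
  case: ifP => [/andP[_ g1]|_]; last by rewrite ler01 lexx.
  have g0 : 0 < (g w N.+1)%:R :> R by rewrite ltr0n ltnW.
  rewrite ler_pdivrMr // mul1r gerBl ler01 andbT.
  by apply: divr_ge0; [rewrite subr_ge0 ler1n ltnW | exact: ltW].
have pp0 N : 0 <= pp N.
  elim: N => [|N IH]; first by rewrite /pp partial0.
  by have [c /andP[c0 _] ->] := ppS N; rewrite mulr_ge0.
have pi_le N : piYF R w <= pp N.
  have dec : {homo pp : m n / (m <= n)%N >-> n <= m}.
    apply/nonincreasing_seqP => n; have [c /andP[_ c1] ->] := ppS n.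
    by rewrite ler_piMr.
  apply: (nonincreasing_cvgn_ge dec); apply: nonincreasing_is_cvgn => //.
  by exists 0 => _ [n _ <-].
(* Only position 0 can have g = 1, where [piYF] skips the factor; it turns the bound 1 into 1 + 2/1
   = 3 once. *)
have key : growth m * pp (twos m) ^+ 2 <= (if m is 0 then 1 else 3).
  elim: m => [|m IH]; first by rewrite /growth big_ord0 /pp partial0 mul1r expr1n.
  rewrite growthS {1}/pp partial_twosS -/(pp _) exprMn mulrACA.
  have G0 : 0 <= growth m * pp (twos m) ^+ 2.
    by rewrite mulr_ge0 ?sqr_ge0 // (le_trans ler01) // growth_ge1.
  case wm : (w m) => /=.
    by rewrite expr1n !mulr1; apply: le_trans IH _; case: (m) => //; rewrite ler1n.
  rewrite -gapE // -(ltr1n R) -gapE //.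
  case: ltP => [g1|g1]; last first.
    have m0 : m = 0%N.
      move: g1; rewrite /gap lern1; have := rank_suffix_ge m; case: (m) => //; lia.
    subst m.
    by rewrite /growth big_ord0 /gap rank_nil /pp partial0; lra.
  apply: (@le_trans _ _ (growth m * pp (twos m) ^+ 2 * 1)).
    apply: ler_wpM2l => //; set x := (gap R w m)^-1.
    have gp : 0 < gap R w m := lt_trans ltr01 g1.
    have x1 : 0 <= x <= 1 by rewrite /x invr_ge0 (ltW gp) invf_le1 // ltW.
    have -> : (gap R w m - 1) / gap R w m = 1 - x.
      by rewrite mulrBl divff ?mul1r // gt_eqF.
    move: x x1 {g1} => x /andP[x0 x1]; nra.
  by rewrite mulr1; apply: le_trans IH _; case: (m) => //; rewrite ler1n.
rewrite ler_pdivlMr ?exprn_gt0 //; apply: (@le_trans _ _ (growth m * pp (twos m) ^+ 2)).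
  apply: ler_wpM2l; first exact: le_trans ler01 (growth_ge1 m).
  by rewrite lerXn2r // nnegrE // ltW.
by apply: le_trans key _; case: (m) => //; rewrite ler1n.
Qed.
End TwoProducts.

(** * Concentration *)

(* The weights [1 / (n + 2)] are superharmonic, up to a factor absorbed by the
   growth of [s ^ 2], resp. of [1 + 2 / g], for the walk that leaves [n] for
   [n - 1] with rate 1 and for [n - 2] with rate [n - 1]. *)
Lemma inv_superharmonic (R : realType) n :
  n.+3%:R^-1 + n.+1%:R / n.+2%:R <= 1 :> R.
Proof.
have E : n.+1%:R = n.+2%:R - 1 :> R by rewrite -[n.+2%:R]natr1 addrK.
rewrite E mulrBl divff ?pnatr_eq0 // mul1r addrCA gerDl subr_le0.
by rewrite lef_pV2 ?posrE ?ltr0n // ler_nat.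
Qed.

Lemma poly_nonneg_ge1 (R : realType) (p : {poly R}) :
  0 <= p.[1] -> (forall s, 1 <= s -> 0 <= p^`().[s]) ->
  forall s, 1 <= s -> 0 <= p.[s].
Proof.
move=> p1 dp s s1; apply: le_trans p1 _.
apply: (@polyrcf.ler_hornerW _ 1 s p) => //; rewrite ?in_itv /= ?lexx ?s1 //.
by move=> x; rewrite in_itv /= => /andP[/ltW/dp].
Qed.

(** The comparison function u = K s^(n+4) / (n+4) has derivative K s^(n+3), which dominates that of
    the polynomial by induction and [inv_superharmonic]; so u plus or minus the polynomial stays
    nonnegative from s = 1 on. *)
Lemma poly_chain_bound (R : realType) (p : nat -> {poly R}) (K : R) l :
  0 <= K ->
  (forall n, (l <= n)%N -> (p n.+2)^`() = p n.+1 + n.+1%:R *: ('X * p n)) ->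
  (forall n s, (n < l.+2)%N -> 1 <= s -> `|(p n).[s]| <= K / n.+2%:R * s ^+ n.+2) ->
  (forall n, `|(p n).[1]| <= K / n.+2%:R) ->
  forall n s, 1 <= s -> `|(p n).[s]| <= K / n.+2%:R * s ^+ n.+2.
Proof.
move=> K0 dp base p1 n; elim/ltn_ind: n => n IH.
have [|ln] := ltnP n l.+2; first by move=> nl s; exact: base.
case: n ln IH => [//|[//|n]] ln IH.
pose u : {poly R} := (K / n.+4%:R) *: 'X^(n.+4).
have du s : 1 <= s -> `|(p n.+2)^`().[s]| <= u^`().[s].
  move=> s1; have s0 : 0 <= s := le_trans ler01 s1.
  rewrite dp // hornerD hornerZ hornerM hornerX.
  have -> : u^`().[s] = K * s ^+ n.+3.
    rewrite /u derivZ derivXn hornerZ hornerMn hornerXn mulrnAr.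
    by rewrite -mulrnAl -[_ *+ _]mulr_natr divfK // pnatr_eq0.
  have H1 := IH n.+1 (ltnSn _) s s1; have H0 := IH n (leqnSn _) s s1.
  apply: (@le_trans _ _ (K / n.+3%:R * s ^+ n.+3 + n.+1%:R * (s * (K / n.+2%:R * s ^+ n.+2)))).
    apply: le_trans (ler_normD _ _) _; apply: lerD => //.
    by rewrite !normrM (ger0_norm s0) normr_nat !ler_wpM2l.
  rewrite -[X in _ <= X]mulr1.
  rewrite [X in X <= _](_ : _ = K * s ^+ n.+3 * (n.+3%:R^-1 + n.+1%:R / n.+2%:R)).
    by rewrite ler_wpM2l ?inv_superharmonic // mulr_ge0 ?exprn_ge0.
  by rewrite (exprS s n.+2); ring.
have u1 : u.[1] = K / n.+4%:R by rewrite hornerZ hornerXn expr1n mulr1.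
move=> s s1; have us : u.[s] = K / n.+4%:R * s ^+ n.+4 by rewrite hornerZ hornerXn.
rewrite -us ler_norml; apply/andP; split.
  rewrite -subr_ge0 opprK addrC -hornerD; apply: (poly_nonneg_ge1 _ _ s1).
    by have := p1 n.+2; rewrite -u1 ler_norml hornerD => /andP[]; lra.
  by move=> t /du; rewrite derivD hornerD ler_norml => /andP[]; lra.
rewrite -subr_ge0 -hornerN -hornerD; apply: (poly_nonneg_ge1 _ _ s1).
  by have := p1 n.+2; rewrite -u1 ler_norml hornerD hornerN => /andP[]; lra.
by move=> t /du; rewrite derivB hornerD hornerN ler_norml => /andP[]; lra.
Qed.

(** Provides one constant for the finitely many levels below l + 2, which the recursion does not
    reach. *)
Lemma uniform_bound (R : realType) (I : Type) (u : I -> nat -> R) L :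
  (forall n, exists M, forall i, `|u i n| <= M) ->
  exists2 K, 0 <= K & forall i n, (n < L)%N -> `|u i n| <= K / n.+2%:R.
Proof.
move=> H; elim: L => [|L [K K0 HK]]; first by exists 0.
have [M HM] := H L; exists (K + `|M| * L.+2%:R).
  by rewrite addr_ge0 // mulr_ge0.
move=> i n; rewrite ltnS leq_eqVlt => /orP[/eqP ->|/(HK i) nK].
  rewrite mulrDl mulfK ?pnatr_eq0 //; apply: le_trans (HM i) _.
  by rewrite ler_wpDl ?divr_ge0 // ler_norm.
by apply: le_trans nK _; rewrite ler_wpM2r // lerDl mulr_ge0.
Qed.

Section Concentration.
Variables (R : realType) (w : iword) (B : pred word) (l : nat) (b : bool).
Hypothesis B_cons : forall a v, (l <= rank v)%N -> B (a :: v) = B v.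
(** The value [b], read as 0 or 1, is the limit to be proved: false for [Qbar], true for [Q]. *)
Hypothesis B_suffix : forall m, (l <= rank (suffix w m))%N -> B (suffix w m) = b.

Lemma level_sum_bound (K : R) : 0 <= K ->
  (forall m n, (n < l.+2)%N ->
     `|level_sum w B (weight R w m) n - b%:R| <= K / n.+2%:R) ->
  forall m n, (n <= rank (suffix w m))%N ->
    `|level_sum w B (weight R w m) n - b%:R| <= K * growth R w m / n.+2%:R.
Proof.
move=> K0 base m n; have Kg k : K <= K * growth R w k.
  by rewrite ler_peMr // growth_ge1.
elim: m n => [|m IH] n nm.
  apply: le_trans (base _ _ _) _; first by move: nm; rewrite rank_nil; lia.
  by rewrite ler_wpM2r.
have [nl|ln] := ltnP n l.+2.
  by apply: le_trans (base _ _ nl) _; rewrite ler_wpM2r.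
(* At the top level the sum is exactly [b], by [level_sum_top]. *)
move: nm; rewrite leq_eqVlt => /orP[/eqP nE|].
  rewrite nE level_sum_top B_suffix -?nE; last by move: ln; lia.
  by rewrite subrr normr0 divr_ge0 // (le_trans K0).
case: n ln => [//|[//|n]] ln.
rewrite suffixS rank_cons growthS; case wm : (w m) => /= nm.
  rewrite mulr1 (_ : level_sum _ _ _ _ = level_sum w B (weight R w m) n.+2).
    by apply: IH; lia.
  by apply: eq_bigr => i _; rewrite weightS wm mul1r.
set g := gap R w m; have g0 : 0 < g by rewrite ltr0n.
rewrite (@level_sum_step _ _ _ _ B_cons n g (weight R w m)) ?gt_eqF //; last first.
  by move=> i; rewrite weightS wm.
set q := level_sum w B (weight R w m).
set G := K * growth R w m; have G0 : 0 <= G := le_trans K0 (Kg m).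
have gn : n.+2%:R <= g by rewrite ler_nat; lia.
(* The three coefficients add up to 1, so [b] can be subtracted inside. *)
have E : (1 - n.+2%:R / g) * q n.+2 + g^-1 * q n.+1 + n.+1%:R / g * q n - b%:R =
  (1 - n.+2%:R / g) * (q n.+2 - b%:R) + g^-1 * (q n.+1 - b%:R)
   + n.+1%:R / g * (q n - b%:R).
  by rewrite -natr1; field; rewrite gt_eqF.
rewrite E.
have c2 : 0 <= 1 - n.+2%:R / g by rewrite subr_ge0 ler_pdivrMr // mul1r.
(* The level n + 2 = g lies one above the reach of the induction hypothesis, but its coefficient is
   then 0. *)
have H2 : (1 - n.+2%:R / g) * `|q n.+2 - b%:R| <= (1 - n.+2%:R / g) * (G / n.+4%:R).
  move: gn; rewrite ler_nat leq_eqVlt => /orP[/eqP gn|gn].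
    by rewrite /g /gap -gn divff ?pnatr_eq0 // subrr !mul0r.
  by rewrite ler_wpM2l // IH.
have H1 : g^-1 * `|q n.+1 - b%:R| <= g^-1 * (G / n.+3%:R).
  by rewrite ler_wpM2l ?invr_ge0 ?(ltW g0) // IH //; lia.
have H0 : n.+1%:R / g * `|q n - b%:R| <= n.+1%:R / g * (G / n.+2%:R).
  by rewrite ler_wpM2l ?divr_ge0 ?(ltW g0) // IH //; lia.
apply: (@le_trans _ _ ((1 - n.+2%:R / g) * `|q n.+2 - b%:R| + g^-1 * `|q n.+1 - b%:R|
   + n.+1%:R / g * `|q n - b%:R|)).
  apply: le_trans (ler_normD _ _) _; apply: lerD.
    apply: le_trans (ler_normD _ _) _.
    by rewrite !normrM (ger0_norm c2) (@ger0_norm _ g^-1) ?invr_ge0 ?(ltW g0).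
  by rewrite normrM ger0_norm // divr_ge0 ?(ltW g0).
apply: le_trans (lerD (lerD H2 H1) H0) _.
rewrite [X in X <= _](_ : _ = (1 - n.+2%:R / g) * (G / n.+4%:R) +
   G / g * (n.+3%:R^-1 + n.+1%:R / n.+2%:R)); last first.
  by field; rewrite ?gt_eqF ?ltr0n.
apply: (@le_trans _ _ ((1 - n.+2%:R / g) * (G / n.+4%:R) + G / g * 1)).
  by rewrite lerD2l ler_wpM2l ?inv_superharmonic // divr_ge0 ?(ltW g0).
(* With N = n + 4, (1 - (N-2)/g) G/N + G/g = (1 + 2/g) G/N, exactly one growth factor. *)
rewrite le_eqVlt; apply/orP; left; apply/eqP.
have -> : n.+2%:R = n.+4%:R - 2 :> R by rewrite -natrB //; congr (_%:R); lia.
have : n.+4%:R != 0 :> R by rewrite pnatr_eq0.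
rewrite mulrA -/G; move: (n.+4%:R) => N N0.
by field; rewrite N0 gt_eqF.
Qed.

Hypothesis pi_gt0 : 0 < piYF R w.

Let c := limit_weight R w.

Lemma level_sum_cvg n :
  level_sum w B (weight R w m) n @[m --> \oo] --> level_sum w B c n.
Proof.
rewrite /level_sum; elim: n.+1 => [|k IH].
  under eq_fun do rewrite big_ord0.
  by rewrite big_ord0; exact: cvg_cst.
under eq_fun do rewrite big_ord_recr /=.
rewrite big_ord_recr /=; apply: cvgD => //.
by apply: cvgM; [exact: weight_cvg | exact: cvg_cst].
Qed.

(** For fixed n, let m tend to infinity in [level_sum_bound]; the low levels are bounded uniformly
    in m because they converge. *)
Lemma limit_level_bound :
  exists2 K, 0 <= K & forall n, `|level_sum w B c n - b%:R| <= K / n.+2%:R.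
Proof.
have [n|K K0 HK] := @uniform_bound R nat
    (fun m n => level_sum w B (weight R w m) n - b%:R) l.+2.
  have cv : cvgn (fun m => level_sum w B (weight R w m) n - b%:R).
    apply/cvg_ex; exists (level_sum w B c n - b%:R).
    by apply: cvgB; [exact: level_sum_cvg | exact: cvg_cst].
  have [M [_ HM]] := cvg_seq_bounded cv.
  by exists (M + 1) => m; apply: HM => //; rewrite ltrDl.
exists (K * (3 / piYF R w ^+ 2)).
  by rewrite mulr_ge0 // divr_ge0 // exprn_ge0 // ltW.
move=> n; have cv : `|level_sum w B (weight R w m) n - b%:R| @[m --> \oo] -->
    `|level_sum w B c n - b%:R|.
  apply: cvg_norm; apply: cvgB; [exact: level_sum_cvg | exact: cvg_cst].
apply: (ler_cvg_to cv (cvg_cst _)); near=> m.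
apply: le_trans (level_sum_bound K0 HK _) _.
  apply: leq_trans (rank_suffix_ge w m); near: m; exact: nbhs_infty_ge.
by rewrite ler_wpM2r // ler_wpM2l // growth_bound.
Unshelve. all: by end_near.
Qed.

(** The polynomial s^n (q_n - b), where q_n has the weights beta^i c_i and s = 1/beta. *)
Definition level_poly n : {poly R} :=
  \sum_(i < n.+1) (c i * coef R w B n i) *: 'X^(n - i) - b%:R *: 'X^n.

Lemma level_poly_widen n N : (n < N)%N -> level_poly n =
  \sum_(i < N) (c i * coef R w B n i) *: 'X^(n - i) - b%:R *: 'X^n.
Proof.
move=> nN; rewrite /level_poly; congr (_ - _).
rewrite -!(big_mkord xpredT (fun i => (c i * coef R w B n i) *: 'X^(n - i))).
rewrite [RHS](@big_cat_nat _ _ _ n.+1) //= [X in _ = _ + X]big_nat.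
rewrite [X in _ = _ + X]big1 ?addr0 //.
by move=> i /andP[ni _]; rewrite coef_gt ?mulr0 ?scale0r.
Qed.

(** Coefficientwise this is [coef_rec], the factor n + 2 - i coming from the exponent; b s^n solves
    the same equation. *)
Lemma deriv_level_poly n : (l <= n)%N ->
  (level_poly n.+2)^`() = level_poly n.+1 + n.+1%:R *: ('X * level_poly n).
Proof.
move=> ln; rewrite (@level_poly_widen n n.+3) 1?(@level_poly_widen n.+1 n.+3) //; last lia.
rewrite /level_poly derivB mulrBr scalerBr addrACA -opprD; congr (_ - _).
  rewrite raddf_sum mulr_sumr scaler_sumr -big_split; apply: eq_bigr => i _ /=.
  rewrite derivZ derivXn -scaler_nat scalerA -scalerAr -exprS scalerA.
  have [ni|ni] := ltnP n i.
    rewrite (@coef_gt R w B _ _ ni) !mulr0 scale0r addr0.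
    move: ni; rewrite leq_eqVlt => /orP[/eqP ni|ni].
      rewrite -ni subnn subSnn /= mulr1; have := @coef_rec R w B l B_cons n n.+1 ln.
      by rewrite -natrB // subSnn mul1r => ->; rewrite (@coef_gt R w B n n.+1) // mulr0 addr0.
    have -> : nat_of_ord i = n.+2 by have := ltn_ord i; lia.
    by rewrite subnn (@coef_gt R w B n.+1 n.+2) // !mulr0 !scale0r.
  have := @coef_rec R w B l B_cons n i ln.
  rewrite -natrB ?leqW // !subSn ?leqW //= -scalerDl => E; congr (_ *: _).
  by rewrite mulrAC -mulrA E; ring.
rewrite derivZ derivXn -[_ *+ n.+2]scaler_nat scalerA -scalerAr -exprS scalerA -scalerDl.
by congr (_ *: _); rewrite -natr1; ring.
Qed.

Lemma horner_level_poly n s : (level_poly n).[s] =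
  \sum_(i < n.+1) c i * coef R w B n i * s ^+ (n - i) - b%:R * s ^+ n.
Proof.
rewrite /level_poly hornerD hornerN hornerZ hornerXn horner_sum; congr (_ - _).
by apply: eq_bigr => i _; rewrite hornerZ hornerXn.
Qed.

Lemma level_poly_bound :
  exists2 K, 0 <= K & forall n s, 1 <= s ->
    `|(level_poly n).[s]| <= K / n.+2%:R * s ^+ n.+2.
Proof.
have [K1 K10 H1] := limit_level_bound.
(* For s >= 1 the absolute values of the coefficients bound the polynomial; the 1 accounts for
   [b]. *)
pose M n : R := \sum_(i < n.+1) `|c i * coef R w B n i| + 1.
have [n|K2 K20 H2] := @uniform_bound R unit (fun _ => M) l.+2.
  by exists `|M n|.
exists (K1 + K2); first exact: addr_ge0.
apply: (poly_chain_bound (l := l)); first exact: addr_ge0.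
- exact: deriv_level_poly.
- move=> n s nl s1; have s0 : 0 <= s := le_trans ler01 s1.
  apply: (@le_trans _ _ (M n * s ^+ n.+2)); last first.
    rewrite ler_wpM2r ?exprn_ge0 //; apply: le_trans (ler_norm _) _.
    by apply: le_trans (H2 tt n nl) _; rewrite ler_wpM2r // lerDr.
  rewrite horner_level_poly /M mulrDl mul1r mulr_suml.
  apply: le_trans (ler_normB _ _) _; apply: lerD.
    apply: le_trans (ler_norm_sum _ _ _) _; apply: ler_sum => i _.
    rewrite normrM ler_wpM2l // ger0_norm ?exprn_ge0 // ler_weXn2l //; lia.
  rewrite ger0_norm ?mulr_ge0 ?exprn_ge0 //.
  apply: (@le_trans _ _ (1 * s ^+ n)); first by rewrite ler_wpM2r ?exprn_ge0 // lern1; case: (b).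
  by rewrite mul1r ler_weXn2l //; lia.
- move=> n; have -> : (level_poly n).[1] = level_sum w B c n - b%:R.
    rewrite horner_level_poly expr1n mulr1; congr (_ - _).
    by apply: eq_bigr => i _; rewrite expr1n mulr1.
  by apply: le_trans (H1 n) _; rewrite ler_wpM2r // lerDl.
Qed.

Lemma mu_sum beta n :
  \sum_(v <- words n | B v) mu w beta v =
  level_sum w B (fun i => beta ^+ i * c i) n.
Proof.
rewrite /level_sum /coef; under [RHS]eq_bigr => i _ do rewrite mulr_sumr.
rewrite exchange_big /= big_seq_cond [RHS]big_seq_cond.
apply: eq_bigr => v; rewrite mem_words => /andP[/eqP vn _].
rewrite /mu /d'_ num_paths_hook vn mulr_sumr; apply: eq_bigr => i _.
by rewrite -/(limit_weight R w i) -/c; ring.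
Qed.

(** At s = 1/beta the factor beta^n absorbs s^n, which leaves an error of at most K beta^(-2) /
    (n+2). *)
Lemma mu_sum_cvg beta : 0 < beta -> beta < 1 ->
  \sum_(v <- words n | B v) mu w beta v @[n --> \oo] --> (b%:R : R).
Proof.
move=> b0 b1; have [K K0 HK] := level_poly_bound.
have s1 : 1 <= beta^-1 by rewrite invf_ge1 // ltW.
have H n : `|b%:R - \sum_(v <- words n | B v) mu w beta v| <=
    K * beta^-1 ^+ 2 / n.+2%:R.
  rewrite mu_sum distrC.
  have -> : level_sum w B (fun i => beta ^+ i * c i) n - b%:R =
      beta ^+ n * (level_poly n).[beta^-1].
    rewrite horner_level_poly mulrBr mulrCA exprVn divff ?expf_neq0 ?gt_eqF // mulr1.
    congr (_ - _); rewrite mulr_sumr; apply: eq_bigr => i _.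
    have -> : beta ^+ n = beta ^+ i * beta ^+ (n - i).
      by rewrite -exprD subnKC // -ltnS.
    have : beta ^+ (n - i) != 0 by rewrite expf_neq0 // gt_eqF.
    by rewrite exprVn; move: (beta ^+ (n - i)) => x x0; field.
  rewrite normrM (ger0_norm (exprn_ge0 _ (ltW b0))).
  apply: le_trans (ler_wpM2l (exprn_ge0 _ (ltW b0)) (HK n _ s1)) _.
  have -> : beta^-1 ^+ n.+2 = (beta ^+ n)^-1 * beta^-1 ^+ 2.
    by rewrite -exprVn -exprD addn2.
  by rewrite mulrCA mulVKf ?expf_neq0 ?gt_eqF // mulrAC.
apply/cvgrPdist_le => e e0; near=> n; apply: le_trans (H n) _.
rewrite ler_pdivrMr // [e * _]mulrC -ler_pdivrMr //.
apply: (@le_trans _ _ n%:R); last by rewrite ler_nat; lia.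
by near: n; exact: nbhs_infty_ger.
Unshelve. all: by end_near.
Qed.

End Concentration.

(** * Passage to the sets [Q] and [Qbar] *)

Lemma mu_fsum_cvg (R : realType) (w : iword) (beta : R) l (b : bool) (A : nat -> set word)
    (B : pred word) :
  (forall n, A n = [set v | YF n v /\ B v]) ->
  (forall a v, (l <= rank v)%N -> B (a :: v) = B v) ->
  (forall m, (l <= rank (suffix w m))%N -> B (suffix w m) = b) ->
  0 < piYF R w -> 0 < beta -> beta < 1 ->
  (\sum_(v \in A n) mu w beta v) @[n --> \oo] --> (b%:R : R).
Proof.
move=> AE Bc Bs pi0 b0 b1.
have E n : \sum_(v \in A n) mu w beta v = \sum_(v <- words n | B v) mu w beta v.
  rewrite -[RHS]big_filter [RHS]fsbig_seq ?filter_uniq ?uniq_words //.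
  rewrite (_ : A n = [set` [seq v <- words n | B v]]) //.
  apply/seteqP; rewrite AE; split => v /=; rewrite mem_filter mem_words.
    by case=> -> ->; rewrite eqxx.
  by case/andP=> -> /eqP.
under eq_fun do rewrite E.
exact: mu_sum_cvg Bc Bs pi0 _ b0 b1.
Qed.

(** The common suffix changes only if v is itself a suffix of w, and then both digit sums are at
    least |v| >= l. *)
Lemma h'_cons a v w l : (l <= rank v)%N -> (l <= h' (a :: v) w)%N = (l <= h' v w)%N.
Proof.
rewrite /h' => lv; case: (h_prolongs a v w) => -[-> // hv].
have E : rank (suffix w (h v w)) = rank v by rewrite hv -(h_full hv).
by rewrite suffixS rank_cons E lv (leq_trans lv) // leq_addl.
Qed.

(* The sums are over finite sets of words, so the finitely supported sum
   notation is the usual sum. *)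
Theorem mainTheorem2 (R : realType) (w : nat -> digit) (beta : R) (l : nat) :
  0 < piYF R w -> 0 < beta -> beta < 1 ->
  (\sum_(v \in Qbar w n l) mu w beta v) @[n --> \oo] --> (0 : R) /\
  (\sum_(v \in Q w n l) mu w beta v) @[n --> \oo] --> (1 : R).
Proof.
move=> pi0 b0 b1; split.
  apply: (@mu_fsum_cvg R w beta l false _ (fun v => h' v w < l)%N) => // [a v|m] lv.
    by rewrite !ltnNge h'_cons.
  by rewrite /h' h_suffix ltnNge lv.
apply: (@mu_fsum_cvg R w beta l true _ (fun v => l <= h' v w)%N) => // [a v|m] lv.
  exact: h'_cons.
by rewrite /h' h_suffix.
Qed.
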